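(* Let $h$ be a positive integer and let $m>1$ satisfy $2^h\le m\le\big(1+\sqrt{\tfrac{m}{m-1}}\big)^h$. Then $\mathcal{G}(\{0,1,m\})=\mathcal{G}\big(\{0,1,\tfrac{m}{m-1}\}\big)=m^{1/h}$.
   Context: For an alphabet (finite set of reals) $A$ with minimum $a_0$ and maximum $a_d$, and $\beta>1$: a $\beta$-expansion of $x$ over $A$ is a sequence $(u_k)_{k\ge1}\in A^{\mathbb{N}}$ with $x=\sum_{k\ge1}u_k\beta^{-k}$; $\mathcal{U}_\beta(A)$ is the set of sequences $(u_k)\in A^{\mathbb{N}}$ such that $\sum_k u_k\beta^{-k}$ has a unique $\beta$-expansion; the generalised golden ratio $\mathcal{G}(A)>1$ is the unique number such that $\mathcal{U}_\beta(A)=\{\overline{a_0},\overline{a_d}\}$ (constant sequences) for $\beta\in(1,\mathcal{G}(A))$ and $\mathcal{U}_\beta(A)$ contains another element for all $\beta>\mathcal{G}(A)$. *)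

(* Defs.v *)
From mathcomp Require Import all_boot all_order all_algebra.
From mathcomp Require Import finmap.
From mathcomp Require Import all_classical all_reals all_analysis.

Set Implicit Arguments.
Unset Strict Implicit.
Unset Printing Implicit Defensive.

Import Order.TTheory GRing.Theory Num.Theory.
Import numFieldNormedType.Exports.

Local Open Scope classical_set_scope.
Local Open Scope ring_scope.

(* A sequence (u_k)_{k >= 1} is a function on nat whose value at k is u_{k+1};
   hence the exponent k.+1. *)
Definition is_expansion (R : realType) (A : {fset R}) (beta x : R)
    (u : nat -> R) : Prop :=
  (forall k, u k \in A) /\
  [series u k / beta ^+ k.+1]_k @ \oo --> x.

Definition univoque (R : realType) (A : {fset R}) (beta : R) :
    set (nat -> R) :=
  [set u | exists x, unique (is_expansion A beta x) u].

(* The infimum and supremum of a nonempty finite set are its minimum and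
   maximum. *)
Definition alphabet_min (R : realType) (A : {fset R}) : R := inf [set` A].
Definition alphabet_max (R : realType) (A : {fset R}) : R := sup [set` A].

Definition trivial_univoque (R : realType) (A : {fset R}) : set (nat -> R) :=
  [set cst (alphabet_min A); cst (alphabet_max A)].

Definition is_golden_ratio (R : realType) (A : {fset R}) (g : R) : Prop :=
  [/\ 1 < g,
      forall beta, 1 < beta -> beta < g ->
        univoque A beta = trivial_univoque A
    & forall beta, g < beta ->
        exists2 u, univoque A beta u & ~ trivial_univoque A u].

Lemma is_golden_ratio_uniq (R : realType) (A : {fset R}) (g1 g2 : R) :
  is_golden_ratio A g1 -> is_golden_ratio A g2 -> g1 = g2.
Proof.
have aux (a b : R) : is_golden_ratio A a -> is_golden_ratio A b -> a <= b.
  move=> [_ ha _] [b1 _ hb]; rewrite leNgt; apply/negP => ltba.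
  have /midf_lt[lbc lca] := ltba.
  have [u + ntu] := hb _ lbc.
  by rewrite (ha _ (lt_trans b1 lbc) lca).
by move=> h1 h2; apply/eqP; rewrite eq_le !aux.
Qed.

(* The default value 0 is taken only when no golden ratio exists; since a golden
   ratio is greater than 1, it is never mistaken for one. *)
Definition golden_ratio (R : realType) (A : {fset R}) : R :=
  xget 0 [set g | is_golden_ratio A g].

Lemma golden_ratioP (R : realType) (A : {fset R}) (g : R) :
  1 < g -> golden_ratio A = g <-> is_golden_ratio A g.
Proof.
move=> g1; rewrite /golden_ratio; split=> [|hg].
  case: xgetP => [y _ hy <- //|_ g0].
  by move: g1; rewrite -g0 ltNge ler01.
by case: xgetP => [y _ /is_golden_ratio_uniq/(_ hg)|/(_ g)].
Qed.

(* Main.v *)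
Require Import Defs.
From mathcomp Require Import all_boot all_order all_algebra.
From mathcomp Require Import finmap.
From mathcomp Require Import all_classical all_reals all_analysis.
From mathcomp Require Import ring lra.

Import Order.TTheory GRing.Theory Num.Theory.
Import numFieldNormedType.Exports.

Local Open Scope ring_scope.

(** Let A = {0, 1, m}, M = m / (b - 1), and let t_k in [0, M] be the tails of an
expansion u, so that b t_k = u_k + t_(k+1).  When every point of [0, M] has an
expansion, u is univoque iff no digit a <> u_k satisfies 0 <= b t_k - a <= M.

For b > m^(1/h) the periodic sequence (m^(h-1) 1)^oo is univoque.  For
b < g = m^(1/h), the bound (m - 1) (g - 1)^2 <= m forbids a 0 after a nonzero
digit.  After a digit 1 the deficit D = M - t lies in (M - m + 1, 1); since
m / b^(h+1) <= M - m + 1, another 1 must occur after i <= h steps, and then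
m >= b^i gives 1 - D' >= b^i (1 - D) for the next deficit D'.  So 1 - D would
grow geometrically along the occurrences of 1, which is absurd: the digit 1 does
not occur, and only the constant sequences 0 and m are left.  The alphabet
{0, 1, m / (m - 1)} is the image of A under x |-> (m - x) / (m - 1). *)

(** * A lower bound for the deficit after a digit 1 *)

Lemma bernoulli_sub (R : realDomainType) (y : R) (n : nat) :
  0 <= y -> y <= 1 -> 1 - n%:R * y <= (1 - y) ^+ n.
Proof.
move=> y0 y1; elim: n => [|n IH]; first by rewrite mul0r subr0 expr0.
rewrite exprS; apply: le_trans (ler_wpM2l _ IH); last by rewrite subr_ge0.
have n0 : 0 <= n%:R :> R by [].
by rewrite -natr1; have := mulr_ge0 n0 (sqr_ge0 y); nra.
Qed.

(* With b = 2 + s and g = b + d, both s and d are O(1/m); Bernoulli's inequality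
   gives b^h >= m (1 - h d / 2), and what remains is polynomial in s and d. *)
Lemma sparse_deficit_bound (R : realFieldType) (h : nat) (m g b : R) :
  2 ^+ h <= m -> 2 <= m -> g ^+ h = m -> (m - 1) * (g - 1) ^+ 2 <= m ->
  2 <= b -> b <= g ->
  m / b ^+ h.+1 <= m / (b - 1) - m + 1.
Proof.
move=> mh m2 gm gP b2 bg.
have h_le : h%:R <= m - 1.
  have : (h < 2 ^ h)%N by apply: ltn_expl.
  rewrite -(ler_nat R) natrX -natr1; lra.
have h0 : 0 <= h%:R :> R by [].
set s := b - 2; set d := g - b; set H : R := h%:R in h_le h0.
have s0 : 0 <= s by rewrite /s; lra.
have d0 : 0 <= d by rewrite /d; lra.
have eg : g = 2 + s + d by rewrite /s /d; ring.
(* This is the bound on [g] rewritten with [(g - 1)^2 = 1 + (s + d)(2 + s + d)]. *)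
have msd : (m - 1) * (s + d) * (2 + s + d) <= 1 by move: gP; rewrite eg; nra.
have msd2 : (m - 1) * (s + d) * 2 <= 1.
  have : 0 <= (m - 1) * (s + d) * (s + d) by rewrite !mulr_ge0 //; lra.
  nra.
have Hd : H * (s + d) * 2 <= 1.
  apply: le_trans msd2; rewrite ler_wpM2r // ler_wpM2r //; lra.
have bh : m * (1 - H * d / 2) <= b ^+ h.
  have -> : b = g * (1 - d / g) by rewrite /d; field; apply: lt0r_neq0; lra.
  rewrite exprMn gm ler_wpM2l //; first lra.
  have dg : d / g <= d / 2.
    by rewrite ler_wpM2l // lef_pV2 ?posrE; lra.
  apply: (@le_trans _ _ (1 - H * (d / g))); last apply: bernoulli_sub.
  - by have := ler_wpM2l h0 dg; rewrite -/H; lra.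
  - by apply: divr_ge0 => //; lra.
  - by rewrite ler_pdivrMr; rewrite /d; lra.
(* [W] is [b] times the numerator of [m / (b - 1) - m + 1 = (1 - (m - 1) s) / (b - 1)], so the goal
   reads [m (1 + s) <= b^h W]. *)
set W := (2 + s) * (1 - (m - 1) * s).
have W_ge : 1 + s + 2 * (m - 1) * d <= W.
  have : 0 <= (m - 1) * (s + d) * d by rewrite !mulr_ge0 //; lra.
  have : 0 <= (m - 1) * s * d by rewrite !mulr_ge0 //; lra.
  rewrite /W; nra.
have s_le : s <= 1 / 2.
  have : 0 <= (m - 2) * (s + d) by rewrite mulr_ge0 //; lra.
  lra.
have Hd_le : H * d <= 1 / 2 by have := mulr_ge0 h0 s0; rewrite -/H; lra.
(* With [X = H d <= Y = (m - 1) d], the factor [1 - X / 2] costs at most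
   [X (1 + s) / 2 + X Y <= 5 Y / 4], which the surplus [2 Y] of [W_ge] covers. *)
have W_key : 1 + s <= (1 - H * d / 2) * W.
  apply: le_trans (ler_wpM2l _ W_ge); last by lra.
  have : H * d <= (m - 1) * d by rewrite ler_wpM2r.
  have : 0 <= H * d by rewrite mulr_ge0.
  set X := H * d in Hd_le *; set Y := (m - 1) * d; rewrite -mulrA -/Y.
  move=> X0 XY; nra.
have key : m * (b - 1) <= b ^+ h.+1 * (1 - (m - 1) * s).
  have -> : b - 1 = 1 + s by rewrite /s; ring.
  have -> : b ^+ h.+1 * (1 - (m - 1) * s) = b ^+ h * W.
    by rewrite exprSr /W /s; ring.
  apply: (@le_trans _ _ (m * (1 - H * d / 2) * W)).
    by rewrite -mulrA ler_wpM2l //; lra.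
  rewrite ler_wpM2r //.
  by have : 0 <= (m - 1) * d by [rewrite mulr_ge0 //; lra]; lra.
have b1 : 0 < b - 1 by lra.
have -> : m / (b - 1) - m + 1 = (1 - (m - 1) * s) / (b - 1).
  by rewrite /s; field; lra.
rewrite ler_pdivrMr ?exprn_gt0 //; last lra.
by rewrite mulrAC ler_pdivlMr // [X in _ <= X]mulrC.
Qed.

(** * Expansions as bounded orbits of tails *)

(** The partial sums lie between those of the constant sequences [lo] and [hi], whose series are
    geometric. *)
Lemma expansion_bounds (R : realType) (beta lo hi x : R) (u : nat -> R) :
  1 < beta -> (forall k, lo <= u k <= hi) ->
  ([series u k / beta ^+ k.+1]_k @ \oo --> x)%classic ->
  lo / (beta - 1) <= x <= hi / (beta - 1).
Proof.
move=> b1 uP ux.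
have V1 : `|beta^-1| < 1.
  by rewrite ger0_norm ?invf_lt1 ?invr_ge0 //; lra.
have geo c : ([series c / beta ^+ k.+1]_k @ \oo --> c / (beta - 1))%classic.
  have -> : c / (beta - 1) = (c / beta) / (1 - beta^-1).
    by field; rewrite subr_eq0 gt_eqF //=; lra.
  suff -> : [series c / beta ^+ k.+1]_k = series (geometric (c / beta) beta^-1).
    exact: cvg_geometric_series.
  by congr series; apply/funext => k /=; rewrite exprVn exprS invfM mulrA.
have b0 k : 0 <= (beta ^+ k)^-1 by rewrite invr_ge0 exprn_ge0 //; lra.
apply/andP; split.
- apply: ler_cvg_to (geo lo) ux _; apply: nearW => n.
  rewrite !seriesEord; apply: ler_sum => i _; rewrite ler_wpM2r //.
  by case/andP: (uP i).
- apply: ler_cvg_to ux (geo hi) _; apply: nearW => n.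
  rewrite !seriesEord; apply: ler_sum => i _; rewrite ler_wpM2r //.
  by case/andP: (uP i).
Qed.

(** Replaces convergence by algebra. A bounded orbit makes the remainder [t n / beta^n] vanish;
    conversely [beta^n (x - S n)] is the sum of the shifted expansion and inherits its bounds. *)
Lemma expansionP (R : realType) (A : {fset R}) (beta lo hi x : R)
    (u : nat -> R) :
  1 < beta -> (forall a, a \in A -> lo <= a <= hi) ->
  is_expansion A beta x u <->
  (forall k, u k \in A) /\ exists t : nat -> R,
    [/\ t 0%N = x, (forall k, lo / (beta - 1) <= t k <= hi / (beta - 1))
      & forall k, beta * t k = u k + t k.+1].
Proof.
move=> b1 Ab; have b0 : 0 < beta by lra.
have bk k : beta ^+ k != 0 by rewrite expf_neq0 ?gt_eqF.
set S := [series u k / beta ^+ k.+1]_k.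
have SS n : S n.+1 = S n + u n / beta ^+ n.+1 by rewrite /S seriesSr.
have S0 : S 0%N = 0 by rewrite /S seriesEord /= big_ord0.
split=> -[uA]; last first.
  case=> t [t0 tb tS]; split=> //.
  have St n : S n = x - t n / beta ^+ n.
    elim: n => [|n IH]; first by rewrite S0 t0 expr0 divr1 subrr.
    rewrite SS IH; have -> : t n = (u n + t n.+1) / beta.
      by rewrite -tS; field; rewrite gt_eqF.
    by rewrite exprS; field; rewrite bk gt_eqF.
  set C := `|lo / (beta - 1)| + `|hi / (beta - 1)|.
  have tC n : `|t n| <= C.
    rewrite /C; case/andP: (tb n) => l r.
    have := ler_norm (hi / (beta - 1)).
    have := lerNnormlW (lexx `|lo / (beta - 1)|).
    have := normr_ge0 (hi / (beta - 1)); have := normr_ge0 (lo / (beta - 1)).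
    by rewrite ler_norml; lra.
  have geo c : (c / beta ^+ n @[n --> \oo] --> 0)%classic.
    have V1 : `|beta^-1| < 1.
      by rewrite ger0_norm ?invf_lt1 ?invr_ge0 //; lra.
    suff -> : (fun n => c / beta ^+ n) = geometric c beta^-1.
      exact: cvg_geometric.
    by apply/funext => k /=; rewrite exprVn.
  have : (t n / beta ^+ n @[n --> \oo] --> 0)%classic.
    apply: (squeeze_cvgr _ (geo (- C)) (geo C)); apply: nearW => n.
    have p : 0 <= (beta ^+ n)^-1 by rewrite invr_ge0 exprn_ge0 ?ltW.
    by have := tC n; rewrite ler_norml => /andP[l r]; rewrite !ler_wpM2r.
  move=> /(cvgB (cvg_cst x)); rewrite subr0.
  rewrite -/S; suff -> : S = cst x - (fun n => t n / beta ^+ n) by [].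
  by apply/funext => n; rewrite St.
move=> Sx; split=> //; exists (fun n => beta ^+ n * (x - S n)); split.
- by rewrite S0 expr0 mul1r subr0.
- move=> n; apply: (@expansion_bounds _ _ _ _ _ (fun k => u (n + k)%N)) => // [k|].
    exact: Ab.
  have tail k : series (fun k => u (n + k)%N / beta ^+ k.+1) k =
      beta ^+ n * (S (k + n)%N - S n).
    rewrite /S series_addn addrC addKr.
    rewrite -[X in \sum_(X <= _ < _) _]add0n big_addn addnK seriesEnat /=.
    rewrite mulr_sumr; apply: eq_bigr => i _.
    rewrite [(i + n)%N]addnC -addnS exprD.
    by set p := beta ^+ i.+1; field; rewrite !bk.
  rewrite (funext tail); apply: cvgM; first exact: cvg_cst.
  apply: cvgB; last exact: cvg_cst.
  by rewrite (cvg_shiftn n).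
- by move=> n; rewrite SS exprS; field; rewrite bk gt_eqF.
Qed.

(** A competing expansion has the same tails, by induction: where the tails agree, a different digit
    would lead to a next tail outside the interval. *)
Lemma univoque_of_orbit (R : realType) (A : {fset R}) (beta lo hi : R)
    (u t : nat -> R) :
  1 < beta -> (forall a, a \in A -> lo <= a <= hi) ->
  (forall k, u k \in A) ->
  (forall k, lo / (beta - 1) <= t k <= hi / (beta - 1)) ->
  (forall k, beta * t k = u k + t k.+1) ->
  (forall k a, a \in A -> a != u k ->
     ~~ (lo / (beta - 1) <= beta * t k - a <= hi / (beta - 1))) ->
  univoque A beta u.
Proof.
move=> b1 Ab uA tb tS tP; exists (t 0%N); split.
  by apply/(expansionP _ _ _ _ _ _ _ b1 Ab); split=> //; exists t.
move=> v /(expansionP _ _ _ _ _ _ _ b1 Ab)[vA [s [s0 sb sS]]].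
have stv k : s k = t k -> u k = v k.
  move=> st; apply/eqP; rewrite eq_sym; apply/negPn/negP => /(tP k _ (vA k)).
  by rewrite -st sS addrAC subrr add0r sb.
have st k : s k = t k.
  elim: k => [//|k IH]; apply: (addrI (u k)).
  by rewrite -tS -IH sS (stv _ IH).
by apply/funext => k; apply: stv.
Qed.

(** If another digit [a] were admissible at place [k], it could be substituted there and continued
    to a second expansion, since every point of the interval has an admissible digit. *)
Lemma orbit_of_univoque (R : realType) (A : {fset R}) (beta lo hi : R)
    (u : nat -> R) :
  1 < beta -> (forall a, a \in A -> lo <= a <= hi) ->
  (forall y, lo / (beta - 1) <= y <= hi / (beta - 1) ->
     exists2 a, a \in A & lo / (beta - 1) <= beta * y - a <= hi / (beta - 1)) ->
  univoque A beta u ->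
  exists t : nat -> R,
    [/\ forall k, lo / (beta - 1) <= t k <= hi / (beta - 1),
      forall k, beta * t k = u k + t k.+1
    & forall k a, a \in A -> a != u k ->
        ~~ (lo / (beta - 1) <= beta * t k - a <= hi / (beta - 1))].
Proof.
move=> b1 Ab fill [x [/(expansionP _ _ _ _ _ _ _ b1 Ab)[uA [t [t0 tb tS]]] uniq]].
exists t; split=> // k a aA auk; apply/negP => ha; case/negP: auk; apply/eqP.
set hull := fun y => lo / (beta - 1) <= y <= hi / (beta - 1).
(* Outside the hull [d] takes the junk value 0; the iterates [s] never leave the hull. *)
have /choice[d dP] : forall y, exists a, hull y -> a \in A /\ hull (beta * y - a).
  move=> y; case: (boolP (hull y)) => [/fill[b bA hb]|hy]; first by exists b.
  by exists 0.
pose s j := iter j (fun y => beta * y - d y) (beta * t k - a).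
have sb j : hull (s j) by elim: j => // j IH; case: (dP _ IH).
(* The tail following the substituted digit is [s 0], at place [k.+1]; hence the shift by [k.+1]. *)
pose v j := if (j < k)%N then u j else if j == k then a else d (s (j - k.+1)%N).
pose t' j := if (j <= k)%N then t j else s (j - k.+1)%N.
have vA j : v j \in A.
  rewrite /v; case: ifP => // _; case: eqP => // _.
  by case: (dP _ (sb (j - k.+1)%N)).
have /uniq /(congr1 (fun w => w k)) : is_expansion A beta x v.
  apply/(expansionP _ _ _ _ _ _ _ b1 Ab); split=> //; exists t'; split.
  - by rewrite /t'.
  - by move=> j; rewrite /t'; case: ifP => _; [apply: tb|apply: sb].
  - move=> j; rewrite /t' /v; case: (ltngtP j k) => [jk|kj|->].
    + exact: tS.
    + by rewrite subSn //= [RHS]addrC subrK.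
    + by rewrite subnn /s /= addrC subrK.
by rewrite /v ltnn eqxx.
Qed.

(** * Affine images of alphabets *)

(** The digit map moves the sum [x] to [c x + d / (beta - 1)], and its inverse carries any competing
    expansion back to [A]. *)
Lemma univoque_affine (R : realType) (A B : {fset R}) (beta c d : R)
    (u : nat -> R) :
  1 < beta -> c != 0 ->
  (forall a, a \in A -> c * a + d \in B) ->
  (forall b, b \in B -> c^-1 * (b - d) \in A) ->
  univoque A beta u -> univoque B beta (fun k => c * u k + d).
Proof.
move=> b1 c0 AB BA [x [ux uniq]].
(* Stated for arbitrary alphabets, to serve for the map and for its inverse. *)
have img (C D : {fset R}) (c' d' y : R) (w : nat -> R) :
    (forall a, a \in C -> c' * a + d' \in D) -> is_expansion C beta y w ->
    is_expansion D beta (c' * y + d' / (beta - 1)) (fun k => c' * w k + d').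
  move=> CD [wC wy]; split=> [k|]; first exact: CD.
  have V1 : `|beta^-1| < 1 by rewrite ger0_norm ?invf_lt1 ?invr_ge0 //; lra.
  have -> : d' / (beta - 1) = (d' / beta) / (1 - beta^-1).
    by field; rewrite subr_eq0 gt_eqF //=; lra.
  have E : [series (c' * w k + d') / beta ^+ k.+1]_k =1
      (fun n => c' * series (fun k => w k / beta ^+ k.+1) n
                + series (geometric (d' / beta) beta^-1) n).
  move=> n; rewrite !seriesEord /=.
  rewrite mulr_sumr -big_split /=; apply: eq_bigr => i _.
  rewrite exprVn exprS.
  have : beta ^+ i != 0 by rewrite expf_neq0 ?gt_eqF //; lra.
  have : beta != 0 by rewrite gt_eqF //; lra.
  by set p := beta ^+ i => bn pn; field; rewrite bn pn.
  rewrite (eq_cvg _ _ E); apply: cvgD; last exact: cvg_geometric_series.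
  by apply: cvgM => //; exact: cvg_cst.
exists (c * x + d / (beta - 1)); split; first exact: img ux.
move=> v vx; apply/funext => k.
have BA' b : b \in B -> c^-1 * b + (- (c^-1 * d)) \in A.
  by move=> /BA; rewrite mulrBr.
have := img _ _ _ _ _ _ BA' vx.
have -> : c^-1 * (c * x + d / (beta - 1)) + - (c^-1 * d) / (beta - 1) = x.
  by field; rewrite c0 subr_eq0 gt_eqF.
by move=> /uniq /(congr1 (fun w => w k)) ->; field.
Qed.

(** * Three-digit alphabets and constant sequences *)

Lemma in_fset3 (K : choiceType) (a b c x : K) :
  (x \in [fset a; b; c]%fset) = [|| x == a, x == b | x == c].
Proof. by rewrite !inE orbA. Qed.

(** All tails equal an endpoint of the interval, and any other digit pushes the next tail beyond
    that endpoint. *)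
Lemma univoque_cst (R : realType) (A : {fset R}) (beta lo hi c : R) :
  1 < beta -> (forall a, a \in A -> lo <= a <= hi) ->
  c \in A -> c = lo \/ c = hi -> univoque A beta (cst c).
Proof.
move=> b1 Ab cA c_lohi.
have /andP[lc ch] := Ab _ cA.
apply: (univoque_of_orbit _ _ _ _ _ _ (cst (c / (beta - 1))) b1 Ab) => //=.
- by move=> _; rewrite !ler_wpM2r ?invr_ge0 //; lra.
- by move=> _; field; rewrite subr_eq0 gt_eqF.
move=> _ a /Ab /andP[la ah] ac.
have -> : beta * (c / (beta - 1)) = c + c / (beta - 1).
  by field; rewrite subr_eq0 gt_eqF.
rewrite negb_and -!ltNge; apply/orP; move: ac; rewrite neq_lt => ac.
by case: c_lohi => ec; [left|right]; rewrite -ec; case/orP: ac; lra.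
Qed.

(** * A nontrivial univoque sequence above the root *)

Lemma univoque_above (R : realType) (h : nat) (m b : R) :
  (0 < h)%N -> 2 ^+ h <= m -> 0 < b -> m < b ^+ h ->
  univoque [fset 0; 1; m]%fset b (fun k => if (h %| k.+1)%N then 1 else m).
Proof.
move=> h0 mh b0 mb.
have b2 : 2 < b.
  by rewrite -(ltr_pXn2r h0) ?nnegrE ?ltW //; apply: le_lt_trans mb.
have m2 : 2 <= m.
  apply: le_trans mh; rewrite -{1}[2]expr1.
  by rewrite ler_eXn2l //; lra.
have b1 : 1 < b by lra.
have Ab a : a \in [fset 0; 1; m]%fset -> 0 <= a <= m.
  by rewrite in_fset3 => /or3P[] /eqP ->; lra.
set P := b ^+ h in mb.
set Q := \sum_(i < h) b ^+ i.
have PQ : P - 1 = (b - 1) * Q by rewrite /P subrX1.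
(* This is [ME] with denominators cleared. For [m = 2^h] it holds termwise, as
   [2^(h - i) < b^(h - i)]; a larger [m] adds a nonnegative multiple of [P - Q]. *)
have mQ : m * Q < (m - 1) * P.
  have : 2 ^+ h * Q < (2 ^+ h - 1) * P.
    have -> : 2 ^+ h - 1 = \sum_(i < h) 2 ^+ i :> R.
      by rewrite subrX1 -[X in X - 1]/(1 + 1) addrK mul1r.
    rewrite mulr_sumr mulr_suml; apply: ltr_sum => [|i _].
      by apply/hasP; exists (Ordinal h0); rewrite ?mem_index_enum.
    have split_h x : x ^+ h = x ^+ (h - i) * x ^+ i :> R.
      by rewrite -exprD subnK // ltnW.
    rewrite /P !split_h.
    rewrite -mulrA [X in _ < X]mulrCA ltr_pM2r ?mulr_gt0 ?exprn_gt0 //.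
    by rewrite ltr_pXn2r ?nnegrE ?subn_gt0 // ltW.
  have : 0 < P by lra.
  set w := 2 ^+ h in mh *; have w0 : 0 < w by rewrite exprn_gt0.
  move=> P0 wQ; have PQ0 : 0 <= P - Q.
    rewrite -(pmulr_rge0 _ w0); lra.
  have := ler_wpM2r PQ0 mh; lra.
(* The deficit M - t_k of the periodic sequence is b^(k mod h) E. *)
pose E := (m - 1) / (P - 1); set M := m / (b - 1).
have PE : P * E = m - 1 + E by rewrite /E; field; lra.
have E1 : E < 1 by rewrite /E ltr_pdivrMr; lra.
have E0 : 0 < E by rewrite /E divr_gt0; lra.
have bM : b * M = m + M by rewrite /M; field; lra.
have ME : M - E < m - 1.
  have Q0 : 0 < Q by rewrite -(pmulr_rgt0 _ (_ : 0 < b - 1)) -?PQ; lra.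
  rewrite /M /E PQ -subr_gt0.
  have -> : m - 1 - (m / (b - 1) - (m - 1) / ((b - 1) * Q)) =
    ((m - 1) * (1 + (b - 1) * Q) - m * Q) / ((b - 1) * Q).
    by field; rewrite gt_eqF //=; lra.
  by rewrite -PQ divr_gt0 ?mulr_gt0 //; lra.
have M0 : 0 < M by rewrite divr_gt0; lra.
have PEm : P * E < m by lra.
have powE i : (i <= h)%N -> b ^+ i * E < m.
  move=> ih; apply: le_lt_trans PEm; rewrite (ler_wpM2r (ltW E0)) //.
  by rewrite /P ler_weXn2l //; lra.
have top k : (h %| k.+1)%N -> b * b ^+ (k %% h) = P.
  move=> hk; rewrite -exprS; congr (b ^+ _); apply/eqP.
  rewrite eqn_leq ltn_mod h0 /= leqNgt; apply/negP => kh.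
  move: hk; rewrite (divn_eq k h) -addnS /dvdn modnMDl.
  by rewrite modn_small.
have low k : ~~ (h %| k.+1)%N -> b * (b ^+ (k %% h).+1 * E) < m.
  move=> hk; rewrite mulrA -exprS powE //.
  by have := modnS k h; rewrite (negPf hk) => <-; rewrite ltn_mod.
have bnd k : b ^+ (k %% h) * E <= M.
  rewrite -(ler_pM2l b0) bM mulrA -exprS; apply: ltW.
  by apply: (lt_trans (powE _ _)); rewrite ?ltn_mod //; lra.
apply: (univoque_of_orbit _ _ _ _ _ _ (fun k => M - b ^+ (k %% h) * E) b1 Ab).
- by move=> k; rewrite in_fset3; case: ifP; rewrite eqxx ?orbT.
- move=> k; rewrite -/M mul0r; have := bnd k.
  have : 0 <= b ^+ (k %% h) * E by rewrite mulr_ge0 ?exprn_ge0 ?ltW.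
  lra.
- move=> k; rewrite modnS; case: ifPn => [hk|_].
    by have := top _ hk; rewrite expr0; rewrite mulrBr bM mulrA => ->; lra.
  by rewrite exprS; lra.
- move=> k a; rewrite in_fset3 -/M mul0r; case: ifPn => [hk|hk].
    have -> : b * (M - b ^+ (k %% h) * E) = M + 1 - E.
      by rewrite mulrBr bM mulrA top // PE; ring.
    by move=> /or3P[] /eqP -> //; rewrite ?eqxx // => _; lra.
  (* A further factor [b > 2] still keeps the deficit below [m]. So [b t_k > M + m / 2 >= M + 1],
     which excludes both 0 and 1. *)
  have : b ^+ (k %% h).+1 * E < m / 2.
    have := low _ hk; set x := b ^+ _ * E => xb.
    have : x < m / b by rewrite ltr_pdivlMr // mulrC.
    have : m / b <= m / 2 by rewrite ler_wpM2l ?lef_pV2 ?posrE; lra.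
    lra.
  rewrite exprS => low_k.
  have : b * (M - b ^+ (k %% h) * E) > M + m / 2 by lra.
  by move=> ? /or3P[] /eqP -> //; rewrite ?eqxx // => _; lra.
Qed.

(** * Only constant univoque sequences below the root *)

Lemma univoque_below (R : realType) (h : nat) (m g b : R) (u : nat -> R) :
  (0 < h)%N -> 2 ^+ h <= m -> 0 < g -> g ^+ h = m ->
  (m - 1) * (g - 1) ^+ 2 <= m -> 1 < b -> b < g ->
  univoque [fset 0; 1; m]%fset b u -> u = cst 0 \/ u = cst m.
Proof.
move=> h0 mh g0 gm gP b1 bg uU.
have m2 : 2 <= m.
  apply: le_trans mh; rewrite -{1}[2]expr1.
  by rewrite ler_eXn2l //; lra.
have bhm : b ^+ h < m by rewrite -gm ltr_pXn2r ?nnegrE //; lra.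
have b_le i : (i <= h)%N -> b ^+ i < m.
  by move=> ih; apply: le_lt_trans bhm; rewrite ler_weXn2l //; lra.
have bm : b < m by have := b_le _ h0; rewrite expr1.
have bP : (m - 1) * (b - 1) ^+ 2 <= m.
  apply: le_trans gP; apply: ler_wpM2l; first lra.
  by rewrite ler_pXn2r ?nnegrE //; lra.
have Ab a : a \in [fset 0; 1; m]%fset -> 0 <= a <= m.
  by rewrite in_fset3 => /or3P[] /eqP ->; lra.
set M := m / (b - 1).
have bM : b * M = m + M by rewrite /M; field; lra.
(* The gaps 1 and [m - 1] between neighbouring digits are at most [M], so every point of [[0, M]]
   has an admissible digit. *)
have M1 : 1 <= M by rewrite /M ler_pdivlMr; lra.
have Mm : m - 1 <= M by rewrite /M ler_pdivlMr; [nra|lra].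
have b0 : 0 < b by lra.
have inv1 : b * b^-1 = 1 by rewrite mulfV ?gt_eqF.
have inv0 : 0 < b^-1 by rewrite invr_gt0.
(* Equivalent to [bP]. The tail after a nonzero digit exceeds [M - m + 1], whereas a 0 there would
   force it below [b^-1]. *)
have Minv : b^-1 <= M - m + 1.
  rewrite -subr_ge0.
  have -> : M - m + 1 - b^-1 = (m - (m - 1) * (b - 1) ^+ 2) / (b * (b - 1)).
    by rewrite /M; field; rewrite !gt_eqF //; lra.
  by apply: divr_ge0; rewrite ?mulr_ge0; lra.
have [|t [tb tS tP]] := orbit_of_univoque _ _ _ _ _ _ b1 Ab _ uU.
  move=> y; rewrite -/M mul0r => /andP[y0 yM].
  have : b * y <= m + M by rewrite -bM ler_wpM2l // ltW.
  have : 0 <= b * y by rewrite mulr_ge0 // ltW.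
  move=> by0 byM; have [h1|h1] := lerP (b * y) M.
    by exists 0; rewrite ?in_fset3 ?eqxx //; lra.
  have [h2|h2] := lerP (b * y) (M + 1).
    by exists 1; rewrite ?in_fset3 ?eqxx ?orbT //; lra.
  by exists m; rewrite ?in_fset3 ?eqxx ?orbT //; lra.
have {}tb k : 0 <= t k <= M by have := tb k; rewrite -/M mul0r.
have {}tP k a : a \in [fset 0; 1; m]%fset -> a != u k ->
    (u k + t k.+1 < a) || (M < u k + t k.+1 - a).
  move=> aA au; have := tP k a aA au; rewrite -/M mul0r tS negb_and -!ltNge.
  by rewrite subr_lt0.
have uA k : u k \in [fset 0; 1; m]%fset.
  by case: uU => x [[]].
(* Each of these four bounds forbids a neighbouring digit; the other alternative in [tP] contradicts
   [0 <= t <= M]. *)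
have d0 k : u k = 0 -> t k.+1 < 1.
  move=> uk; have := tP k 1; rewrite uk in_fset3 eqxx orbT.
  by move=> /(_ isT (oner_neq0 _)) /orP[]; have := tb k.+1; lra.
have d1l k : u k = 1 -> M - 1 < t k.+1.
  move=> uk; have := tP k 0; rewrite uk in_fset3 eqxx eq_sym oner_neq0.
  by move=> /(_ isT isT) /orP[]; have := tb k.+1; lra.
have d1r k : u k = 1 -> t k.+1 < m - 1.
  move=> uk; have := tP k m; rewrite uk in_fset3 eqxx !orbT gt_eqF; last lra.
  by move=> /(_ isT isT) /orP[]; have := tb k.+1; lra.
have dm k : u k = m -> M - m + 1 < t k.+1.
  move=> uk; have := tP k 1; rewrite uk in_fset3 eqxx orbT lt_eqF; last lra.
  by move=> /(_ isT isT) /orP[]; have := tb k.+1; lra.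
have nz k : u k != 0 -> u k.+1 != 0.
  move=> uk; apply/eqP => /[dup] uk1 /d0.
  have := tS k.+1; rewrite uk1 add0r => <-.
  suff : b^-1 <= t k.+1 by rewrite -(ler_pM2l b0) inv1; lra.
  have := uA k; rewrite in_fset3 (negPf uk) /= => /orP[]/eqP.
    by move/d1l; nra.
  by move/dm; lra.
have no1 k : u k != 1.
  apply/eqP => uk.
  (* The tail after a 1 lies between [M - 1] and [m - 1], so [M < m]. *)
  have b2 : 2 <= b.
    have := d1l _ uk; have := d1r _ uk => h1 h2.
    have : M < m by lra.
    rewrite /M ltr_pdivrMr; nra.
  have sparse := @sparse_deficit_bound _ h m g b mh m2 gm gP b2 (ltW bg).
  have step j : u j = 1 -> exists2 j', u j' = 1 &
      b * (1 - (M - t j.+1)) <= 1 - (M - t j'.+1).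
    move=> uj.
    have D1 := d1l _ uj.
    have Dm := d1r _ uj.
    (* Until the next 1 all digits are [m], by [nz], and each multiplies the deficit by [b]. *)
    suff H i : (i <= h)%N -> (exists2 j', u j' = 1 &
      b * (1 - (M - t j.+1)) <= 1 - (M - t j'.+1)) \/
      (M - t (j.+1 + i)%N = b ^+ i * (M - t j.+1) /\ u (j + i)%N != 0).
      case: (H h (leqnn _)) => // -[e /nz]; rewrite -addSn => unz; exfalso.
      (* After [h] digits [m], [sparse] makes [b] times the deficit exceed [m], while either nonzero
         digit keeps it below [m]. *)
      have : m < b * (M - t (j.+1 + h)%N).
        rewrite e mulrA -exprS mulrC -ltr_pdivrMr ?exprn_gt0 //.
        by apply: le_lt_trans sparse _; rewrite -/M; lra.
      rewrite mulrBr bM tS.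
      have := uA (j.+1 + h)%N; rewrite in_fset3 (negPf unz) /= => /orP[]/eqP uj1.
        by rewrite uj1; have := d1l _ uj1; lra.
      by rewrite uj1; have := dm _ uj1; lra.
    elim: i => [|i IH] ih.
      by right; rewrite !addn0 expr0 mul1r uj oner_neq0.
    have [|[e /nz]] := IH (ltnW ih); first by left.
    rewrite -addSn => unz.
    have := tS (j.+1 + i)%N.
    have := uA (j.+1 + i)%N; rewrite in_fset3 (negPf unz) /= => /orP[]/eqP uji.
      rewrite uji => tji; left; exists (j.+1 + i)%N => //.
      have bp := b_le _ ih.
      have pb : b <= b ^+ i.+1 by rewrite -{1}[b]expr1 ler_weXn2l // ltW.
      (* With [p = b^(i + 1) < m] and new deficit [D'], [1 - D' = m - p D >= p (1 - D) >= b (1 -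
         D)]. *)
      have : b ^+ i.+1 * (M - t j.+1) = m - 1 + (M - t (j.+1 + i).+1).
        by rewrite exprS -mulrA -e mulrBr bM tji; ring.
      set p := b ^+ i.+1 in bp pb *; set D := M - t j.+1 => pD.
      have D_lt1 : D < 1 by rewrite /D; lra.
      have : b * (1 - D) <= p * (1 - D) by rewrite ler_wpM2r //; lra.
      lra.
    rewrite uji => tji; right; rewrite !addnS exprS -mulrA -e; split.
      by rewrite mulrBr tji bM; ring.
    by rewrite -addSn uji; lra.
  have grow n : exists2 j, u j = 1 &
      b ^+ n * (1 - (M - t k.+1)) <= 1 - (M - t j.+1).
    elim: n => [|n [j uj le]]; first by exists k => //; rewrite expr0 mul1r.
    have [j' uj' le'] := step _ uj; exists j' => //; apply: le_trans le'.
    by rewrite exprS -mulrA ler_pM2l.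
  set e := 1 - (M - t k.+1) in grow.
  have e0 : 0 < e by have := d1l _ uk; rewrite /e; lra.
  (* The exponent [n] exceeds [1 / e], so [b^n e >= 2^n e > 1], while [1 - (M - t) <= 1]. *)
  have [j uj le] := grow (Num.truncn e^-1).+1.
  have : (Num.truncn e^-1).+1%:R <= b ^+ (Num.truncn e^-1).+1.
    apply: (@le_trans _ _ (2 ^+ (Num.truncn e^-1).+1)).
      by rewrite -natrX ler_nat ltnW // ltn_expl.
    by rewrite ler_pXn2r ?nnegrE //; lra.
  have := truncnS_gt e^-1; set n := (_.+1)%:R => n_gt n_le.
  have : 1 < n * e by rewrite -ltr_pdivrMr // mul1r.
  have : n * e <= b ^+ (Num.truncn e^-1).+1 * e by rewrite ler_wpM2r // ltW.
  by have := tb j.+1; lra.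
have u0m k : u k != 0 -> u k = m.
  move=> uk; have := uA k; rewrite in_fset3 (negPf uk) (negPf (no1 _)) /=.
  by move/eqP.
have stay0 k : u k = 0 -> u k.+1 = 0.
  move=> uk; have [//|/u0m um] := eqVneq (u k.+1) 0; exfalso.
  have := d0 _ uk; have := tS k.+1; rewrite um; have := dm _ um.
  move=> h1 h2 h3.
  (* A digit [m] after a 0 gives [M + 1 < b], so [m = M (b - 1) < (b - 1)^2]; then [bP] would force
     [m < 2]. *)
  have h4 : M + 1 < b by have := ltr_pM2l b0 (t k.+1) 1; rewrite h3 mulr1; lra.
  have : m < (b - 1) ^+ 2.
    have : M * (b - 1) = m by rewrite /M divfK //; lra.
    nra.
  nra.
have [u0|u0] := eqVneq (u 0%N) 0; [left|right]; apply/funext.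
  by elim=> // k; apply: stay0.
suff unz k : u k != 0 by move=> k; apply: u0m.
by elim: k => // k; apply: nz.
Qed.

(** * Golden ratios of the two alphabets *)

Lemma trivial_univoqueE (R : realType) (A : {fset R}) (lo hi : R) :
  lo \in A -> hi \in A -> (forall a, a \in A -> lo <= a <= hi) ->
  trivial_univoque A = [set cst lo; cst hi]%classic.
Proof.
move=> loA hiA Ab; rewrite /trivial_univoque.
have lbA : lbound [set` A]%classic lo by move=> a /= /Ab /andP[].
have ubA : ubound [set` A]%classic hi by move=> a /= /Ab /andP[].
have -> : alphabet_min A = lo.
  apply/eqP; rewrite eq_le lb_le_inf //=; last by exists lo.
  by rewrite andbT; apply: ge_inf => //; exists lo.
have -> // : alphabet_max A = hi.
apply/eqP; rewrite eq_le ge_sup //=; last by exists lo.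
by apply: ub_le_sup => //; exists hi.
Qed.

(** A map with [c < 0] exchanges the extreme digits, hence the two trivial sequences, and
    [univoque_affine] applies in both directions. *)
Lemma is_golden_ratio_reflect (R : realType) (A B : {fset R})
    (c d lo hi g : R) :
  c < 0 -> lo \in A -> hi \in A -> (forall a, a \in A -> lo <= a <= hi) ->
  (forall a, a \in A -> c * a + d \in B) ->
  (forall b, b \in B -> c^-1 * (b - d) \in A) ->
  is_golden_ratio A g -> is_golden_ratio B g.
Proof.
move=> c0 loA hiA Ab AB BA [g1 below above].
have cn0 : c != 0 by rewrite lt_eqF.
have cK x : c * (c^-1 * (x - d)) + d = x by field.
have Bb b : b \in B -> c * hi + d <= b <= c * lo + d.
  move=> /BA /Ab /andP[l r]; rewrite -{1}[b]cK -{2}[b]cK !lerD2r.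
  by rewrite !ler_nM2l // l r.
have trA := trivial_univoqueE _ _ _ _ loA hiA Ab.
have trB := trivial_univoqueE _ _ _ _ (AB _ hiA) (AB _ loA) Bb.
split=> // [b b1 bg|b gb].
- rewrite trB; apply/seteqP; split=> [v vU|v [->|->]] /=; last first.
  + by apply: (univoque_cst _ _ _ _ _ _ b1 Bb); [apply: AB|right].
  + by apply: (univoque_cst _ _ _ _ _ _ b1 Bb); [apply: AB|left].
  have BA' a : a \in B -> c^-1 * a + (- (c^-1 * d)) \in A.
    by move=> /BA; rewrite mulrBr.
  have AB' a : a \in A -> c^-1^-1 * (a - (- (c^-1 * d))) \in B.
    suff -> : c^-1^-1 * (a - (- (c^-1 * d))) = c * a + d by apply: AB.
    by rewrite invrK; field.
  have := univoque_affine _ _ _ _ _ _ _ b1 (invr_neq0 cn0) BA' AB' vU.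
  rewrite (below _ b1 bg) trA => -[] e; [right|left]; apply/funext => k;
    have := congr1 (fun w => w k) e => /= <-; field; exact: cn0.
- have b1 : 1 < b := lt_trans g1 gb.
  have [u uU nu] := above _ gb.
  exists (fun k => c * u k + d); first exact: univoque_affine uU.
  rewrite trB; contradict nu; rewrite trA; case: nu => e; [right|left];
    apply/funext => k; have := congr1 (fun w => w k) e => /= /addIr;
    exact: mulfI.
Qed.

Lemma is_golden_ratio_root (R : realType) (h : nat) (m g : R) :
  (0 < h)%N -> 2 ^+ h <= m -> 0 < g -> g ^+ h = m ->
  (m - 1) * (g - 1) ^+ 2 <= m -> is_golden_ratio [fset 0; 1; m]%fset g.
Proof.
move=> h0 mh g0 gm gP.
have m2 : 2 <= m.
  apply: le_trans mh; rewrite -{1}[2]expr1.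
  by rewrite ler_eXn2l //; lra.
have g2 : 2 <= g by rewrite -(ler_pXn2r h0) ?nnegrE ?gm //; lra.
have A0 : 0 \in [fset 0; 1; m]%fset by rewrite in_fset3 eqxx.
have Am : m \in [fset 0; 1; m]%fset by rewrite in_fset3 eqxx !orbT.
have Ab a : a \in [fset 0; 1; m]%fset -> 0 <= a <= m.
  by rewrite in_fset3 => /or3P[] /eqP ->; lra.
split; first lra; last first.
  move=> b gb; exists (fun k => if (h %| k.+1)%N then 1 else m).
    apply: univoque_above => //; first lra.
    by rewrite -gm ltr_pXn2r ?nnegrE //; lra.
  rewrite (trivial_univoqueE _ _ _ _ A0 Am Ab).
  (* At index [h.-1] the sequence takes the value 1, which is neither 0 nor [m]. *)
  have hh : (h %| h.-1.+1)%N by rewrite prednK.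
  move=> [] /(congr1 (fun w => w h.-1)); rewrite hh /=; lra.
move=> b b1 bg; rewrite (trivial_univoqueE _ _ _ _ A0 Am Ab).
apply/seteqP; split=> [u|u [->|->]].
- by case/(univoque_below _ _ _ _ _ _ h0 mh g0 gm gP b1 bg) => ->; [left|right].
- by apply: (univoque_cst _ _ _ _ _ _ b1 Ab) => //; left.
- by apply: (univoque_cst _ _ _ _ _ _ b1 Ab) => //; right.
Qed.

Theorem theorem4 (R : realType) (h : nat) (m : R)
    (h_gt0 : (0 < h)%N) (m_gt1 : 1 < m)
    (m_ge : 2 ^+ h <= m)
    (m_le : m <= (1 + Num.sqrt (m / (m - 1))) ^+ h) :
  golden_ratio [fset 0; 1; m]%fset = golden_ratio [fset 0; 1; m / (m - 1)]%fset
  /\ golden_ratio [fset 0; 1; m / (m - 1)]%fset = m `^ (h%:R^-1).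
Proof.
set g := m `^ (h%:R^-1).
have m1 : 0 < m - 1 by lra.
have g0 : 0 < g by apply: powR_gt0; lra.
have gm : g ^+ h = m.
  rewrite -powR_mulrn ?ltW // /g -powRrM mulVf ?powRr1 //; first lra.
  by rewrite pnatr_eq0 -lt0n.
have g2 : 2 <= g by rewrite -(ler_pXn2r h_gt0) ?nnegrE ?gm //; lra.
have q0 : 0 <= m / (m - 1) by rewrite divr_ge0 //; lra.
(* The upper bound on [m] says [g - 1 <= sqrt (m / (m - 1))]; squaring removes the root. *)
have gP : (m - 1) * (g - 1) ^+ 2 <= m.
  have s0 := sqrtr_ge0 (m / (m - 1)).
  have : g <= 1 + Num.sqrt (m / (m - 1)).
    by rewrite -(ler_pXn2r h_gt0) ?nnegrE ?gm //; lra.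
  move=> gs; rewrite mulrC -ler_pdivlMr //.
  by rewrite -(sqr_sqrtr q0) ler_pXn2r ?nnegrE //; lra.
have gold := is_golden_ratio_root _ _ _ _ h_gt0 m_ge g0 gm gP.
have g1 : 1 < g by lra.
suff goldB : is_golden_ratio [fset 0; 1; m / (m - 1)]%fset g.
  by rewrite !(golden_ratioP _ g1).2.
have mn0 : m - 1 != 0 by rewrite gt_eqF.
(* The reflection sends 0, 1, [m] to [m / (m - 1)], 1, 0. *)
apply: (is_golden_ratio_reflect _ [fset 0; 1; m]%fset _ (- (m - 1)^-1)
  (m / (m - 1)) 0 m _ _ _ _ _ _ _ gold).
- by rewrite oppr_lt0 invr_gt0.
- by rewrite in_fset3 eqxx.
- by rewrite in_fset3 eqxx !orbT.
- by move=> a; rewrite in_fset3 => /or3P[] /eqP ->; lra.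
- move=> a; rewrite !in_fset3 => /or3P[] /eqP ->; apply/or3P.
  + by apply: Or33; apply/eqP; field.
  + by apply: Or32; apply/eqP; field.
  + by apply: Or31; apply/eqP; field.
- move=> a; rewrite !in_fset3 => /or3P[] /eqP ->; apply/or3P.
  + by apply: Or33; apply/eqP; field.
  + by apply: Or32; apply/eqP; field.
  + by apply: Or31; apply/eqP; field.
Qed.
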